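(* $2.2818564 < \rho^*(\mathcal{B}_2) < 2.5823284$.
   Context: For a positive integer $n$, $[n]=\{1,\dots,n\}$ and $\mathcal{B}_n$ denotes the family of all subsets of $[n]$ ordered by inclusion; $\mathcal{B}_2$ is thus the 4-element Boolean lattice (the diamond). A family $\mathcal{F}\subseteq\mathcal{B}_n$ contains a copy of a poset $P$ if some subset of $\mathcal{F}$, with the order induced by inclusion, is isomorphic to $P$; otherwise $\mathcal{F}$ is $P$-free. The Lubell function is $\ell(\mathcal{F})=\sum_{A\in\mathcal{F}}1/\binom{n}{|A|}$. Define $\rho^*(P)=\limsup_{n\to\infty}\sup\{\ell(\mathcal{F}) : \emptyset\in\mathcal{F}\subseteq\mathcal{B}_n,\ \mathcal{F}\text{ is }P\text{-free}\}$. *)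

(* Defs.v *)
From mathcomp Require Import all_boot all_order all_algebra.
From mathcomp Require Import all_classical all_reals all_analysis.

Set Implicit Arguments.
Unset Strict Implicit.
Unset Printing Implicit Defensive.

Import Order.TTheory GRing.Theory Num.Theory.
Import Order.DefaultSetSubsetOrder.

Local Open Scope classical_set_scope.
Local Open Scope ring_scope.

(* 'I_n = {0, ..., n-1} plays the role of [n]; the order on {set 'I_n} is the
   inclusion order of DefaultSetSubsetOrder. *)
Definition boolean_lattice (n : nat) :
    finPOrderType Order.SetSubsetOrder.subset_display :=
  Order.FinPOrder.clone _ {set 'I_n} _.

(* Copies are induced: f is an isomorphism from P onto the subfamily G ordered
   by inclusion. *)
Definition contains_copy (d : Order.disp_t) (P : finPOrderType d) (n : nat)
    (F : {set {set 'I_n}}) : Prop :=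
  exists2 G : {set {set 'I_n}}, G \subset F &
    exists f : P -> {set 'I_n},
      [/\ injective f, f @: P = G
        & forall x y : P, (f x \subset f y) = (x <= y)%O].

Definition poset_free (d : Order.disp_t) (P : finPOrderType d) (n : nat)
    (F : {set {set 'I_n}}) : Prop := ~ contains_copy P F.

Definition lubell (R : realType) (n : nat) (F : {set {set 'I_n}}) : R :=
  \sum_(A in F) 'C(n, #|A|)%:R^-1.

(* Extended-real valued, so that neither the supremum nor the limsup has a junk
   value when unbounded; the n = 0 term does not affect the limsup. *)
Definition rho_star (R : realType) (d : Order.disp_t) (P : finPOrderType d) :
    \bar R :=
  limn_esup (fun n : nat =>
    ereal_sup [set (lubell R F)%:E | F in
      [set F : {set {set 'I_n}} | finset.set0 \in F /\ poset_free P F]]).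

(* Main.v *)
Require Import Defs.
From mathcomp Require Import all_boot all_order all_algebra.
From mathcomp Require Import reals.
From mathcomp Require Import zify lra ring.

(** A family containing the empty set has no induced diamond iff its nonempty
    members form a forest: the members below any given member are a chain.

    Upper bound.  Let [avoid F C] be the probability that a random maximal chain
    from the empty set to [C] meets [F] nowhere strictly below [C].  Counting the
    first member met by a random maximal chain gives the LYM-type inequality
    [\sum_(A in F) avoid F A / 'C(n, #|A|) <= 1].  In a forest, [avoid F C] only
    depends on the set of sizes of the members below [C]; it is at least 2/3 when
    no singleton of [F] lies below [C], and always at least 1/2.  Let [p] be the
    proportion of points [x] with [[set x] \in F] and [q = 1 - p].  A member of
    size at least 2 contains at most one such [x], and removing it leaves a forest
    on the other points, of Lubell weight at most 2 and at most 1 on each level.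
    Hence the members whose [avoid] is below 2/3 have a total weight controlled by
    a polynomial in [q], and optimising over [q] gives 1.581 for the nonempty part.

    Lower bound.  Split the points into parts [X], [Y], [Z] in proportions
    37 : 80 : 37 (close to the optimal ones) and take the sets meeting ([X], [Y], [Z]) in (1,0,0), (1,1,0),
    (0,2,0), (0,0,2), (1,1,1), (0,2,1) or (0,1,2) points. *)

Set Implicit Arguments.
Unset Strict Implicit.
Unset Printing Implicit Defensive.

Import Order.TTheory GRing.Theory Num.Theory.

Local Open Scope ring_scope.

(** * Polynomial inequalities for the final optimisation *)

(** With [p = 1 - q], this and [cubic_bound] control [p * K - p / 2], the gain over 3/2 in
    [forest_lubell_le], for the two possible values of [K]. *)
Lemma quartic_bound (R : realFieldType) (q : R) : 0 <= q -> q <= 1 ->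
  (1 - q) * (3 / 4 * q ^+ 2 + 3 / 4 * q ^+ 3 - 1 / 2) <= 8 / 100.
Proof.
(* The maximum on [[0, 1]] is attained near 0.836, where these squares almost vanish. *)
move=> q0 q1; have := sqr_ge0 (q * (q - 836 / 1000)).
have := sqr_ge0 (q - 836 / 1000).
have := mulr_ge0 q0 (sqr_ge0 (q - 836 / 1000)).
by nra.
Qed.

Lemma cubic_bound (R : realFieldType) (q : R) : 0 <= q -> q <= 1 ->
  (1 - q) * (1 / 2 * q + 3 / 4 * q ^+ 2 - 1 / 2) <= 8 / 100.
Proof.
(* Here the maximum is attained near 0.787. *)
move=> q0 q1; have := sqr_ge0 (q - 787 / 1000).
have := mulr_ge0 q0 (sqr_ge0 (q - 787 / 1000)).
by nra.
Qed.

(** * Random maximal chains and the LYM-type identity *)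

(* The chain is built downwards from [C] by deleting uniform points. *)
Fixpoint avoid_rec (R : realFieldType) (T : finType) (F : {set {set T}})
    (k : nat) (C : {set T}) : R :=
  if k is k'.+1 then
    (\sum_(x in C | C :\ x \notin F) avoid_rec R F k' (C :\ x)) / k%:R
  else 1.

Definition avoid (R : realFieldType) (T : finType) (F : {set {set T}})
  (C : {set T}) : R := avoid_rec R F #|C| C.

Lemma avoid_ge0 (R : realFieldType) (T : finType) (F : {set {set T}}) C :
  0 <= avoid R F C.
Proof.
rewrite /avoid; move: #|C| => k; elim: k C => [|k IHk] C /=; first exact: ler01.
by rewrite divr_ge0 ?ler0n ?sumr_ge0.
Qed.

(** A random maximal chain up to [C] either meets no member strictly below [C], or has a lowest such
    member [A]: it passes through [A] with probability [1 / 'C(#|C|, #|A|)] and then avoids the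
    members below [A]. The induction conditions on the point deleted first from [C]. *)
Lemma avoid_lym (R : realFieldType) (T : finType) (F : {set {set T}}) C :
  avoid R F C +
  \sum_(A in F | A \proper C) avoid R F A / 'C(#|C|, #|A|)%:R = 1.
Proof.
have [k] := ubnP #|C|; elim: k C => // k IHk C; rewrite ltnS => leCk.
case: (posnP #|C|) => [/eqP|C_gt0].
  rewrite cards_eq0 => /eqP->; rewrite /avoid cards0 /= big1 ?addr0 // => A.
  by rewrite properE sub0set andbF andbF.
have -> : avoid R F C =
    (\sum_(x in C | C :\ x \notin F) avoid R F (C :\ x)) / #|C|%:R.
  rewrite /avoid; case E: #|C| C_gt0 => [//|c] _ /=; congr (_ / _).
  by apply: eq_bigr => x /andP[xC _]; move: E; rewrite (cardsD1 x) xC add1n => -[->].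
have IH x : x \in C -> (if C :\ x \notin F then avoid R F (C :\ x) else 0) =
    1 - \sum_(A in F | A \subset C :\ x) avoid R F A / 'C(#|C|.-1, #|A|)%:R.
  move=> xC; have cx : #|C :\ x| = #|C|.-1 by rewrite (cardsD1 x C) xC.
  have := IHk (C :\ x); rewrite cx prednK // => /(_ leCk) E.
  rewrite -[X in _ = X - _]E {E}.
  (* When [C :\ x] is a member, its own term in the sum is exactly the [avoid R F (C :\ x)] missing
     on the left. *)
  have [xF|xF] := boolP (C :\ x \in F); last first.
    rewrite [X in _ = _ - X](eq_bigl (fun A =>
      (A \in F) && (A \proper C :\ x))) ?addrK //.
    move=> A /=; rewrite properEneq; case: eqVneq => // -> /=.
    by rewrite (negPf xF).
  rewrite [X in _ = _ - X](bigD1 (C :\ x)) /= ?xF ?subxx // cx binn divr1.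
  rewrite [X in _ = _ - (_ + X)](eq_bigl (fun A =>
    (A \in F) && (A \proper C :\ x))) ?subrr //.
  by move=> A /=; rewrite properEneq -andbA [_ && (_ != _)]andbC.
rewrite big_mkcondr /= (eq_bigr (fun x => 1 - \sum_(A in F | A \subset C :\ x)
   avoid R F A / 'C(#|C|.-1, #|A|)%:R)); last first.
  by move=> x xC; rewrite -IH.
have C0 : #|C|%:R != 0 :> R by rewrite pnatr_eq0 -lt0n.
rewrite sumrB sumr_const mulrBl divff // -[RHS]subr0 -addrA; congr (_ + _).
apply/eqP; rewrite addrC oppr0 subr_eq0; apply/eqP.
(* Double counting: [A] occurs once for each [x] in [C :\: A], and with [c = #|C|], [a = #|A|] one
   has [(c - a) / (c * 'C(c.-1, a)) = 1 / 'C(c, a)]. *)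
rewrite (exchange_big_dep (fun A => (A \in F) && (A \proper C))) /=; last first.
  move=> x A xC /andP[-> /subsetD1P[AC xA]] /=.
  by rewrite properE AC; apply/subsetPn; exists x.
rewrite mulr_suml; apply: eq_bigr => A /andP[AF AC].
rewrite (eq_bigl (fun x => x \in C :\: A)); last first.
  move=> x; rewrite /= !inE AF /=; case xC: (x \in C) => /=; last by rewrite andbF.
  rewrite andbT; apply/subsetD1P/idP => [[]//|xA]; split=> //; exact: proper_sub.
rewrite sumr_const -[_ *+ #|C :\: A|]mulr_natr -!mulrA; congr (_ * _).
rewrite cardsD (setIidPr (proper_sub AC)).
have ltAC := proper_card AC.
have b1 : 'C(#|C|.-1, #|A|)%:R != 0 :> R by rewrite pnatr_eq0 -lt0n bin_gt0; lia.
have b2 : 'C(#|C|, #|A|)%:R != 0 :> R by rewrite pnatr_eq0 -lt0n bin_gt0; lia.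
have /(congr1 (fun m : nat => m%:R : R)) := mul_bin_down #|C| #|A|.
rewrite !natrM => E; apply: (mulIf b2); apply: (mulIf b1); apply: (mulIf C0).
by move: E; set u := (_ - _)%:R => E; field: E; rewrite ?b1 ?b2 ?C0.
Qed.

(** * Sums of reciprocals of binomial coefficients *)

(** Each reciprocal in row [b] is a fixed multiple of the sum of two neighbours in row [b.+1];
    summing meets every entry of that row twice, except the two ends, met once. *)
Lemma sum_inv_binS (R : realFieldType) (b : nat) :
  \sum_(i < b.+2) 'C(b.+1, i)%:R^-1 =
  b.+2%:R / (2 * b.+1%:R) * (\sum_(i < b.+1) 'C(b, i)%:R^-1) + 1 :> R.
Proof.
have step (i : 'I_b.+1) : 'C(b, i)%:R^-1 =
    b.+1%:R / b.+2%:R * ('C(b.+1, i)%:R^-1 + 'C(b.+1, i.+1)%:R^-1) :> R.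
  have le_ib : (i <= b)%N by rewrite -ltnS.
  have n0 k : k.+1%:R != 0 :> R by rewrite pnatr_eq0.
  have c0 n k : (k <= n)%N -> 'C(n, k)%:R != 0 :> R.
    by move=> ?; rewrite pnatr_eq0 -lt0n bin_gt0.
  have c1 := c0 _ _ le_ib; have c2 := c0 _ _ (leqW le_ib).
  have c3 : 'C(b.+1, i.+1)%:R != 0 :> R by apply: c0.
  have /(congr1 (fun m : nat => m%:R : R)) := mul_bin_down b.+1 i.
  have /(congr1 (fun m : nat => m%:R : R)) := mul_bin_diag b.+1 i.
  rewrite /= !natrM => E1 E2.
  have -> : 'C(b.+1, i.+1)%:R^-1 = i.+1%:R / (b.+1%:R * 'C(b, i)%:R) :> R.
    by rewrite E1 invfM mulrA divff ?mul1r.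
  have -> : 'C(b.+1, i)%:R^-1 = (b.+1 - i)%:R / (b.+1%:R * 'C(b, i)%:R) :> R.
    by rewrite E2 invfM mulrA divff ?mul1r // pnatr_eq0 subn_eq0 -ltnNge ltnS.
  rewrite -mulrDl -natrD (_ : b.+1 - i + i.+1 = b.+2)%N; last by lia.
  by field; rewrite c1 nat1r -natrD !pnatr_eq0.
rewrite (eq_bigr _ (fun i _ => step i)) -mulr_sumr big_split /=.
set S := (X in X = _).
have -> : \sum_(i < b.+1) 'C(b.+1, i)%:R^-1 = S - 1.
  by rewrite /S [X in _ = X - _]big_ord_recr /= binn invr1 addrK.
have -> : \sum_(i < b.+1) 'C(b.+1, i.+1)%:R^-1 = S - 1.
  by rewrite /S [X in _ = X - _]big_ord_recl bin0 invr1 addrC addKr.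
by field; rewrite nat1r -natrD !pnatr_eq0.
Qed.

(** Row 8 still exceeds 7/3; row 9 does not, and from there the recurrence preserves the bound. *)
Lemma sum_inv_bin_le (R : realFieldType) (b : nat) : (9 <= b)%N ->
  \sum_(i < b.+1) 'C(b, i)%:R^-1 <= 7 / 3 :> R.
Proof.
elim: b => // b IHb; rewrite leq_eqVlt => /orP[/eqP <- | le9b].
  rewrite !sum_inv_binS big_ord_recl big_ord0 bin0 invr1; lra.
have b9 : 9 <= b%:R :> R by rewrite ler_nat.
have {}IHb := IHb le9b.
have b0 : 0 < 2 * (1 + b%:R) :> R by lra.
rewrite sum_inv_binS -lerBrDr -[b.+2%:R]natr1 -[b.+1%:R]natr1.
rewrite mulrAC ler_pdivrMr; last by lra.
nra.
Qed.

Ltac unroll_bin :=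
  rewrite ?big_ord_recr ?big_ord0 /=;
  repeat match goal with |- context [binomial ?n ?k] =>
    let v := eval vm_compute in (binomial n k) in
    change (binomial n k) with v end.


(** * Lower bounds on avoidance from the sizes occurring below a member *)

(* In a forest, [s a] is the value of [avoid] at the unique member of size [a]
   strictly below a given member of size [b], or 0 if there is none. *)
Definition avoid_profile (R : realFieldType) (s : nat -> R) (b : nat) : Prop :=
  [/\ s 0%N = 0, forall a, 0 <= s a <= 1
    & forall a, (a < b)%N ->
      s a = 0 \/ s a = 1 - \sum_(i < a) s i / 'C(a, i)%:R].

(* For [b <= 6] this is the value when the chain below is full, i.e. the
   proportion of indecomposable permutations of [b] letters; larger values are
   cut down to 2/3. *)
Definition rooted_bound (R : realFieldType) (b : nat) : R :=
  match b with
  | 2 | 3 => 1 / 2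
  | 4 => 13 / 24
  | 5 => 71 / 120
  | 6 => 461 / 720
  | _ => 2 / 3
  end.

Lemma rooted_bound_ge (R : realFieldType) (b : nat) :
  1 / 2 <= rooted_bound R b.
Proof. by do 7?[case: b => [|b] /=; first lra]; lra. Qed.

(** The two end terms of the row, each equal to 1, do not contribute: [s 0 = 0], and [i = b] is
    outside the sum. At most 7/3 - 2 = 1/3 remains. *)
Lemma profile_large (R : realFieldType) (s : nat -> R) (b : nat) :
  (9 <= b)%N -> avoid_profile s b ->
  2 / 3 <= 1 - \sum_(i < b) s i / 'C(b, i)%:R.
Proof.
move=> b9 [s0 s01 _]; have := sum_inv_bin_le R b9.
case: b b9 => // b _; rewrite big_ord_recr big_ord_recl /= binn bin0 invr1.
rewrite [X in _ -> _ <= 1 - X]big_ord_recl /= s0 mul0r => S.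
suff : \sum_(i < b) s (bump 0 i) / 'C(b.+1, bump 0 i)%:R <=
       \sum_(i < b) 'C(b.+1, bump 0 i)%:R^-1 by lra.
apply: ler_sum => i _; rewrite -[leRHS]mul1r ler_wpM2r ?invr_ge0 ?ler0n //.
by case/andP: (s01 (bump 0 i)).
Qed.

Lemma unrooted_profile_ge (R : realFieldType) (s : nat -> R) (b : nat) :
  (0 < b)%N -> avoid_profile s b -> s 1%N = 0 ->
  2 / 3 <= 1 - \sum_(i < b) s i / 'C(b, i)%:R.
Proof.
move=> b_gt0 Hb s1; have [/profile_large/(_ Hb)//|] := leqP 9 b.
case: Hb => s0 s01 Hs.
case: b b_gt0 Hs => [//|[|[|[|[|[|[|[|[|//]]]]]]]]] _ Hs _.
- unroll_bin; lra.
- unroll_bin; lra.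
- have /andP[? ?] := s01 2; unroll_bin; lra.
(* For [b] = 4, 5, 6 the bound [s i <= 1] alone is too weak; the recursion is used, branching on
   which sizes occur. For [b] = 7, 8 it suffices again. *)
- have := Hs 3 isT; have /andP[? ?] := s01 2; have /andP[? ?] := s01 3.
  by unroll_bin => -[] ?; lra.
- have := Hs 4 isT; have := Hs 3 isT; have := Hs 2 isT; unroll_bin.
  by do ![case] => ? ? ?; lra.
- have := Hs 5 isT; have := Hs 4 isT; have := Hs 3 isT; have := Hs 2 isT.
  by unroll_bin; do ![case] => ? ? ? ?; lra.
- have /andP[? ?] := s01 2; have /andP[? ?] := s01 3; have /andP[? ?] := s01 4.
  by have /andP[? ?] := s01 5; have /andP[? ?] := s01 6; unroll_bin; lra.
- have /andP[? ?] := s01 2; have /andP[? ?] := s01 3; have /andP[? ?] := s01 4.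
  have /andP[? ?] := s01 5; have /andP[? ?] := s01 6; have /andP[? ?] := s01 7.
  by unroll_bin; lra.
Qed.

Lemma rooted_profile_ge (R : realFieldType) (s : nat -> R) (b : nat) :
  (1 < b)%N -> avoid_profile s b -> s 1%N = 1 ->
  rooted_bound R b <= 1 - \sum_(i < b) s i / 'C(b, i)%:R.
Proof.
move=> b_gt1 Hb s1; have [b9|] := leqP 9 b.
  have := profile_large b9 Hb; do 7?[case: b b9 b_gt1 Hb => [//|b] b9 b_gt1 Hb].
  by [].
case: Hb => s0 s01 Hs.
case: b b_gt1 Hs => [//|[//|[|[|[|[|[|[|[|//]]]]]]]]] _ Hs _ /=.
- unroll_bin; lra.
- have := Hs 2 isT; unroll_bin; by case=> ?; lra.
- have := Hs 3 isT; have := Hs 2 isT; unroll_bin.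
  by do ![case] => ? ?; lra.
- have := Hs 4 isT; have := Hs 3 isT; have := Hs 2 isT; unroll_bin.
  by do ![case] => ? ? ?; lra.
- have := Hs 5 isT; have := Hs 4 isT; have := Hs 3 isT; have := Hs 2 isT.
  by unroll_bin; do ![case] => ? ? ? ?; lra.
- have := Hs 6 isT; have := Hs 5 isT; have := Hs 4 isT; have := Hs 3 isT.
  by have := Hs 2 isT; unroll_bin; do ![case] => ? ? ? ? ?; lra.
(* For [b = 8] the singleton's term in the recursion gives [s k <= 1 - 1 / k], which is already
   enough without branching on all sizes at once. *)
- have /andP[? ?] := s01 2; have /andP[? ?] := s01 3; have /andP[? ?] := s01 4.
  have /andP[? ?] := s01 5; have /andP[? ?] := s01 6; have /andP[? ?] := s01 7.
  have u2 : s 2%N <= 1 / 2 by have := Hs 2 isT; unroll_bin; case=> ?; lra.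
  have u3 : s 3%N <= 2 / 3 by have := Hs 3 isT; unroll_bin; case=> ?; lra.
  have u4 : s 4%N <= 3 / 4 by have := Hs 4 isT; unroll_bin; case=> ?; lra.
  have u5 : s 5%N <= 4 / 5 by have := Hs 5 isT; unroll_bin; case=> ?; lra.
  have u6 : s 6%N <= 5 / 6 by have := Hs 6 isT; unroll_bin; case=> ?; lra.
  have u7 : s 7%N <= 6 / 7 by have := Hs 7 isT; unroll_bin; case=> ?; lra.
  by unroll_bin; lra.
Qed.

(** * Avoidance in forests *)

Definition forest (T : finType) (F : {set {set T}}) : Prop :=
  finset.set0 \notin F /\
  forall A B C, A \in F -> B \in F -> C \in F ->
    A \subset C -> B \subset C -> (A \subset B) || (B \subset A).

(** In a forest with [C] a member, the sum has at most one term. As a sum it is 0 at an absent size,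
    and [avoid_levels] holds for every family. *)
Definition level_avoid (R : realFieldType) (T : finType) (F : {set {set T}})
    (C : {set T}) (a : nat) : R :=
  \sum_(A in F | (A \proper C) && (#|A| == a)) avoid R F A.

Lemma avoid_levels (R : realFieldType) (T : finType) (F : {set {set T}}) C :
  avoid R F C = 1 - \sum_(a < #|C|) level_avoid R F C a / 'C(#|C|, a)%:R.
Proof.
rewrite -[X in _ = X - _](avoid_lym R F C); apply/eqP.
rewrite eq_sym subr_eq; apply/eqP; congr (_ + _).
rewrite (eq_bigr (fun A : {set T} => \sum_(a < #|C| | #|A| == a)
   avoid R F A / 'C(#|C|, a)%:R)); last first.
  move=> A /andP[_ /proper_card ltAC].
  rewrite (eq_bigl (pred1 (Ordinal ltAC))) ?big_pred1_eq //.
rewrite (exchange_big_dep predT) //=; apply: eq_bigr => a _.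
rewrite /level_avoid mulr_suml; apply: eq_bigl => A; by rewrite -andbA.
Qed.

Lemma forest_subset (T : finType) (F : {set {set T}}) A B C : forest F ->
  A \in F -> B \in F -> C \in F -> A \subset C -> B \subset C ->
  (#|A| <= #|B|)%N -> A \subset B.
Proof.
move=> [_ Ff] AF BF CF sAC sBC leAB; case/orP: (Ff A B C AF BF CF sAC sBC) => // BA.
by have /eqP-> : B == A by rewrite eqEcard BA.
Qed.

Lemma avoid_le1 (R : realFieldType) (T : finType) (F : {set {set T}}) C :
  avoid R F C <= 1.
Proof.
rewrite -[leRHS](avoid_lym R F C) lerDl sumr_ge0 // => A _.
by rewrite divr_ge0 ?avoid_ge0 ?ler0n.
Qed.

Lemma level_avoid_eq (R : realFieldType) (T : finType) (F : {set {set T}}) A C :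
  forest F -> C \in F -> A \in F -> A \proper C ->
  level_avoid R F C #|A| = avoid R F A.
Proof.
move=> Ff CF AF sAC; rewrite /level_avoid (eq_bigl (pred1 A)) ?big_pred1_eq //.
move=> B /=; apply/idP/eqP => [/and3P[BF sBC /eqP cB]|->]; last by rewrite AF sAC /=.
have AB : A \subset B.
  by apply: (forest_subset Ff AF BF CF); rewrite ?proper_sub ?cB.
by apply/esym/eqP; rewrite eqEcard AB cB leqnn.
Qed.

Lemma level_avoid_neq0 (R : realFieldType) (T : finType) (F : {set {set T}}) C a :
  level_avoid R F C a != 0 -> exists A, [/\ A \in F, A \proper C & #|A| = a].
Proof.
have [A /and3P[AF sAC /eqP ca] _|none] :=
  pickP (fun A => [&& A \in F, A \proper C & #|A| == a]).
  by exists A.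
by rewrite /level_avoid big_pred0 ?eqxx.
Qed.

(** If [A] is a member below [C], every smaller member below [C] lies below [A], so the levels of
    [A] and of [C] agree under size [#|A|]. *)
Lemma forest_profile (R : realFieldType) (T : finType) (F : {set {set T}}) C :
  forest F -> C \in F -> avoid_profile (level_avoid R F C) #|C|.
Proof.
move=> Ff CF; have lev a : level_avoid R F C a = 0 \/
    exists A, [/\ A \in F, A \proper C & #|A| = a].
  by have [->|/level_avoid_neq0] := eqVneq (level_avoid R F C a) 0; [left|right].
split.
- case: (lev 0%N) => // -[A [AF _ /eqP]]; rewrite cards_eq0 => /eqP A0.
  by case: Ff => /negP[]; rewrite -A0.
- move=> a; case: (lev a) => [->|[A [AF sAC <-]]]; first by rewrite lexx ler01.
  by rewrite level_avoid_eq // avoid_ge0 avoid_le1.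
move=> a _; case: (lev a) => [->|[A [AF sAC <-]]]; [by left | right].
rewrite level_avoid_eq // avoid_levels; congr (1 - _).
apply: eq_bigr => i _; congr (_ / _); apply: eq_bigl => B.
have [BF|//] := boolP (B \in F); have [/eqP cB|] := eqVneq #|B| i; last by rewrite !andbF.
rewrite !andbT /=; apply/idP/idP => BP; first exact: proper_trans sAC.
rewrite properEcard (eqP cB) ltn_ord andbT.
apply: (forest_subset Ff BF AF CF); rewrite ?proper_sub //.
by rewrite (eqP cB) ltnW.
Qed.

Lemma forest_card_gt0 (T : finType) (F : {set {set T}}) C :
  forest F -> C \in F -> (0 < #|C|)%N.
Proof.
move=> [F0 _] CF; rewrite lt0n cards_eq0; apply: contraNneq F0 => <-//.
Qed.

Lemma avoid_singleton (R : realFieldType) (T : finType) (F : {set {set T}}) x :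
  forest F -> [set x] \in F -> avoid R F [set x] = 1.
Proof.
move=> Ff xF; rewrite avoid_levels cards1 big_ord_recl big_ord0.
by have [-> _ _] := forest_profile R Ff xF; rewrite mul0r addr0 subr0.
Qed.

Lemma level_avoid1 (R : realFieldType) (T : finType) (F : {set {set T}}) C x :
  forest F -> C \in F -> (1 < #|C|)%N -> [set x] \in F -> x \in C ->
  level_avoid R F C 1 = 1.
Proof.
move=> Ff CF C1 xF xC.
have xpC : [set x] \proper C by rewrite properEcard sub1set xC cards1.
by rewrite -(cards1 x) level_avoid_eq // avoid_singleton.
Qed.

Lemma avoid_rooted (R : realFieldType) (T : finType) (F : {set {set T}}) C x :
  forest F -> C \in F -> (1 < #|C|)%N -> [set x] \in F -> x \in C ->
  rooted_bound R #|C| <= avoid R F C.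
Proof.
move=> Ff CF C1 xF xC; rewrite avoid_levels; apply: rooted_profile_ge => //.
  exact: forest_profile.
exact: level_avoid1 xF xC.
Qed.

(** Only singletons strictly below [C] are excluded, so [C] may itself be one; this is what makes
    level 1 of its profile vanish. *)
Lemma avoid_unrooted (R : realFieldType) (T : finType) (F : {set {set T}}) C :
  forest F -> C \in F -> (forall x, x \in C -> [set x] \in F -> C = [set x]) ->
  2 / 3 <= avoid R F C.
Proof.
move=> Ff CF nx; rewrite avoid_levels; apply: unrooted_profile_ge.
- exact: forest_card_gt0 CF.
- exact: forest_profile.
apply/eqP; apply/negP => /negP/level_avoid_neq0[A [AF sAC /eqP/cards1P[x Ax]]].
have xC : x \in C by rewrite (subsetP (proper_sub sAC)) // Ax set11.
by move: sAC; rewrite Ax (nx x xC) ?properxx // -Ax.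
Qed.

Lemma avoid_ge_half (R : realFieldType) (T : finType) (F : {set {set T}}) C :
  forest F -> C \in F -> 1 / 2 <= avoid R F C.
Proof.
move=> Ff CF.
have [/existsP[x /and3P[xC xF neq]]|none] :=
  boolP [exists x, [&& x \in C, [set x] \in F & C != [set x]]].
  apply: le_trans (rooted_bound_ge R #|C|) _.
  apply: (avoid_rooted R Ff CF _ xF xC).
  by rewrite (cardsD1 x) xC ltnS lt0n cards_eq0; apply: contra neq;
     rewrite setD_eq0 subset1 => /predU1P[->//|/eqP C0]; rewrite C0 inE in xC.
suff : 2 / 3 <= avoid R F C by lra.
apply: avoid_unrooted => // x xC xF; apply/eqP; apply: contraNT none => neq.
by apply/existsP; exists x; rewrite xC xF.
Qed.

(** If [D] is a member, its own term is the leading [avoid R F D] of [avoid_lym]; otherwise that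
    nonnegative quantity is dropped. *)
Lemma avoid_lym_le (R : realFieldType) (T : finType) (F : {set {set T}}) (D : {set T}) :
  \sum_(A in F | A \subset D) avoid R F A / 'C(#|D|, #|A|)%:R <= 1.
Proof.
rewrite -[leRHS](avoid_lym R F D).
have [DF|DF] := boolP (D \in F).
  rewrite (bigD1 D) /= ?DF ?subxx // binn divr1 lerD2l.
  rewrite [leLHS](eq_bigl (fun A => (A \in F) && (A \proper D))) //.
  by move=> A; rewrite properEneq -andbA [_ && (_ != _)]andbC.
rewrite [leLHS](eq_bigl (fun A => (A \in F) && (A \proper D))) ?lerDr ?avoid_ge0 //.
by move=> A; rewrite properEneq; case: eqVneq => // ->; rewrite (negPf DF).
Qed.

(** * Comparing falling factorials with powers *)

(** Each factor [1 - i / N] with [i <= 5] loses at most [5 / N], so a product of [k] of them is at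
    least [1 - 5 * k / N]; denominators are cleared. *)
Lemma ffact_ge (R : realFieldType) (N k : nat) : (k <= 6)%N -> (30 <= N)%N ->
  N%:R ^+ k * (N%:R - 5 * k%:R) <= N%:R * (N ^_ k)%:R :> R.
Proof.
move=> k6 N30; have N30R : 30 <= N%:R :> R by rewrite ler_nat.
elim: k k6 => [_|k IHk k6]; first by rewrite expr0 ffactn0; lra.
have {}IHk := IHk (ltnW k6).
rewrite ffactnSr natrM natrB ?exprSr; last by lia.
have k5 : k%:R <= 5 :> R by rewrite ler_nat.
have k0 : 0 <= k%:R :> R by rewrite ler0n.
have : 0 <= N%:R ^+ k :> R by rewrite exprn_ge0 ?ler0n.
move: IHk; rewrite -natr1; set x : R := N%:R ^+ k; set y : R := (N ^_ k)%:R.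
set t : R := N%:R in N30R *; set u : R := k%:R in k5 k0 * => IHk x0.
have : x * (t - 5 * u) * (t - u) <= t * y * (t - u) by rewrite ler_wpM2r; lra.
have : 0 <= x * (5 * u ^+ 2 + (5 - u) * t) by rewrite mulr_ge0 //; nra.
by nra.
Qed.

(* The factor 1001/1000 absorbs the difference between drawing with and without
   replacement. *)
Lemma bin_ratio_le (R : realFieldType) (m N j : nat) :
  (j <= 5)%N -> (200 * 200 <= N)%N ->
  'C(m, j)%:R * N%:R ^+ j.+1 <=
  1001 / 1000 * (j.+1%:R * m%:R ^+ j * 'C(N, j.+1)%:R) :> R.
Proof.
move=> j5 N4; have N4R : 200 * 200 <= N%:R :> R by rewrite -natrM ler_nat.
have N30 : (30 <= N)%N by apply: leq_trans N4.
have H := @ffact_ge R N j.+1 j5 N30.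
have j6 : j.+1%:R <= 6 :> R by rewrite ler_nat.
have j1 : 0 <= j.+1%:R :> R by rewrite ler0n.
have e : 0 <= N%:R ^+ j.+1 :> R by rewrite exprn_ge0 ?ler0n.
have N0 : 0 < N%:R :> R by lra.
have ff : N%:R ^+ j.+1 <= 1001 / 1000 * (N ^_ j.+1)%:R :> R.
  rewrite -(ler_pM2l N0) mulrCA.
  have : N%:R ^+ j.+1 * (N%:R - 30) <= N%:R * (N ^_ j.+1)%:R :> R.
    by apply: le_trans H; rewrite ler_wpM2l //; lra.
  (* Nonnegativity of the second factor amounts to [N >= 30030], within the threshold
     [200 * 200]. *)
  have : 0 <= N%:R ^+ j.+1 * (N%:R / 1000 - 30 * 1001 / 1000) :> R.
    by rewrite mulr_ge0 //; lra.
  by nra.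
have mf : (m ^_ j)%:R <= m%:R ^+ j :> R.
  rewrite -natrX ler_nat; elim: j {H j5 j6 j1 e ff} => // j IHj.
  by rewrite ffactnSr expnSr leq_mul ?leq_subr.
rewrite -bin_ffact natrM in mf; rewrite -bin_ffact natrM factS natrM in ff.
have f0 : 0 < (j`!)%:R :> R by rewrite ltr0n fact_gt0.
rewrite -(ler_pM2r f0) mulrAC.
apply: (le_trans (ler_pM _ e mf ff)); first by rewrite mulr_ge0 ?ler0n.
by rewrite le_eqVlt; apply/orP; left; apply/eqP; ring.
Qed.

(** * Weighted Lubell sums over a forest *)

Lemma sub_level_le1 (R : realFieldType) (T : finType) (H : {set {set T}})
    (Y : {set T}) (j : nat) :
  \sum_(B in H | (B \subset Y) && (#|B| == j)) 'C(#|Y|, #|B|)%:R^-1 <= 1 :> R.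
Proof.
rewrite (eq_bigr (fun=> 'C(#|Y|, j)%:R^-1)); last by move=> B /and3P[_ _ /eqP->].
rewrite sumr_const; have [->|c0] := posnP 'C(#|Y|, j).
  by rewrite invr0 mul0rn ler01.
rewrite -[leLHS]mulr_natl ler_pdivrMr ?ltr0n // mul1r ler_nat -cards_draws.
by apply/subset_leq_card/subsetP => B; rewrite !inE => /and3P[_ -> ->].
Qed.

(** Every member has [avoid] at least 1/2, so half of this sum is at most 1 by [avoid_lym_le]. *)
Lemma forest_lubell_le2 (R : realFieldType) (T : finType) (H : {set {set T}})
    (Y : {set T}) : forest H ->
  \sum_(B in H | B \subset Y) 'C(#|Y|, #|B|)%:R^-1 <= 2 :> R.
Proof.
move=> Hf; suff : (\sum_(B in H | B \subset Y) 'C(#|Y|, #|B|)%:R^-1) / 2 <= 1 :> R.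
  by lra.
apply: le_trans (avoid_lym_le R H Y); rewrite mulr_suml.
apply: ler_sum => B /andP[BH _]; rewrite mulrC ler_wpM2r ?invr_ge0 ?ler0n //.
by have := avoid_ge_half R Hf BH; lra.
Qed.

(** The total Lubell weight is at most 2 and that of level [i] at most 1, so [theta] is paid twice
    and [delta] once. *)
Lemma forest_weighted_le (R : realFieldType) (T : finType) (H : {set {set T}})
    (Y : {set T}) (c : nat -> R) (theta delta : R) (i : nat) :
  forest H -> 0 <= theta -> 0 <= delta ->
  (forall j, (0 < j)%N -> c j <= theta + (if j == i then delta else 0)) ->
  \sum_(B in H | B \subset Y) c #|B| / 'C(#|Y|, #|B|)%:R <= 2 * theta + delta.
Proof.
move=> Hf th0 de0 cle.
apply: (@le_trans _ _ (theta * (\sum_(B in H | B \subset Y) 'C(#|Y|, #|B|)%:R^-1)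
  + delta * (\sum_(B in H | (B \subset Y) && (#|B| == i)) 'C(#|Y|, #|B|)%:R^-1))).
  rewrite !mulr_sumr.
  rewrite [X in _ <= _ + X](eq_bigl (fun B : {set T} =>
      ((B \in H) && (B \subset Y)) && (#|B| == i))); last by move=> B; rewrite andbA.
  rewrite [X in _ <= _ + X]big_mkcondr -big_split /=; apply: ler_sum => B /andP[BH _].
  have := cle _ (forest_card_gt0 Hf BH); case: ifP => _ cB; last first.
    by rewrite addr0 ler_wpM2r ?invr_ge0 ?ler0n //; lra.
  by rewrite -mulrDl ler_wpM2r ?invr_ge0 ?ler0n.
rewrite [2 * _]mulrC lerD ?ler_wpM2l ?forest_lubell_le2 //.
by rewrite -[leRHS]mulr1 ler_wpM2l ?sub_level_le1.
Qed.

(** Relative shortfall of [rooted_bound] from 2/3. *)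
Definition excess (R : realFieldType) (b : nat) : R := 1 - 3 / 2 * rooted_bound R b.

Lemma excess_ge0 (R : realFieldType) (b : nat) : 0 <= excess R b.
Proof. by rewrite /excess; do 7?[case: b => [|b] /=; first lra]; lra. Qed.

Lemma excess_eq0 (R : realFieldType) (b : nat) : (6 < b)%N -> excess R b = 0.
Proof. by do 7?[case: b => // b]; move=> _; rewrite /excess /=; lra. Qed.

(** The level weights are [q / 2], [3 / 4 * q ^+ 2], and at most [3 / 4 * q ^+ 3] from level 3 on.
    By [forest_weighted_le] the sum is at most the two largest of these three added together. *)
Lemma link_weight_le (R : realFieldType) (T : finType) (H : {set {set T}})
    (Y : {set T}) (q : R) : forest H -> 0 <= q <= 1 ->
  \sum_(B in H | B \subset Y)
     (#|B|.+1%:R * excess R #|B|.+1 * q ^+ #|B|) / 'C(#|Y|, #|B|)%:R <=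
  Num.max (3 / 4 * q ^+ 2 + 3 / 4 * q ^+ 3) (1 / 2 * q + 3 / 4 * q ^+ 2).
Proof.
move=> Hf /andP[q0 q1].
pose c (j : nat) : R := j.+1%:R * excess R j.+1 * q ^+ j.
have q2 : 0 <= q ^+ 2 by rewrite exprn_ge0.
have q3 : 0 <= q ^+ 3 by rewrite exprn_ge0.
have q32 : q ^+ 3 <= q ^+ 2 by rewrite exprSr ler_piMr.
have c1 : c 1%N = 1 / 2 * q by rewrite /c /excess /=; lra.
have c2 : c 2%N = 3 / 4 * q ^+ 2 by rewrite /c /excess /=; lra.
have c3 j : (2 < j)%N -> c j <= 3 / 4 * q ^+ 3.
  have q43 : q ^+ 4 <= q ^+ 3 by rewrite exprSr ler_piMr.
  have q54 : q ^+ 5 <= q ^+ 4 by rewrite exprSr ler_piMr ?exprn_ge0.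
  case: j => [|[|[|[|[|[|j]]]]]] // _; rewrite /c.
  - by rewrite /excess /=; lra.
  - by rewrite /excess /=; lra.
  - by rewrite /excess /=; lra.
  by rewrite excess_eq0 // mulr0 mul0r; lra.
(* In each case [theta] is the second largest of the three bounds, and [delta] its distance to the
   largest, placed at level [i]. *)
rewrite le_max; have [c13|c31] := lerP (1 / 2 * q) (3 / 4 * q ^+ 3).
  apply/orP; left; apply: le_trans (forest_weighted_le Y (c := c)
    (theta := 3 / 4 * q ^+ 3) (delta := 3 / 4 * q ^+ 2 - 3 / 4 * q ^+ 3) (i := 2%N)
    Hf _ _ _) _; [lra|lra| |lra].
  by move=> [|[|[|j]]] // _ /=; rewrite ?c1 ?c2 ?addr0; [lra|lra|exact: c3].
apply/orP; right; have [c12|c21] := lerP (1 / 2 * q) (3 / 4 * q ^+ 2).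
  apply: le_trans (forest_weighted_le Y (c := c)
    (theta := 1 / 2 * q) (delta := 3 / 4 * q ^+ 2 - 1 / 2 * q) (i := 2%N)
    Hf _ _ _) _; [lra|lra| |lra].
  move=> [|[|[|j]]] // _ /=; rewrite ?c1 ?c2 ?addr0; [lra|lra|].
  by have := c3 j.+3 isT; lra.
apply: le_trans (forest_weighted_le Y (c := c)
  (theta := 3 / 4 * q ^+ 2) (delta := 1 / 2 * q - 3 / 4 * q ^+ 2) (i := 1%N)
  Hf _ _ _) _; [lra|lra| |lra].
move=> [|[|[|j]]] // _ /=; rewrite ?c1 ?c2 ?addr0; [lra|lra|].
by have := c3 j.+3 isT; lra.
Qed.

(** * Singletons of a forest and their links *)

Definition roots (T : finType) (F : {set {set T}}) : {set T} :=
  [set x | [set x] \in F].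

(** The size condition discards [[set x]], which would leave the empty set. *)
Definition link (T : finType) (F : {set {set T}}) (x : T) : {set {set T}} :=
  [set A :\ x | A in [set A in F | (1 < #|A|)%N && (x \in A)]].

Lemma setD1_subset (T : finType) (A B : {set T}) (x : T) :
  x \in A -> x \in B -> (A :\ x \subset B :\ x) = (A \subset B).
Proof.
move=> xA xB; apply/idP/idP => [AB|]; last exact: setSD.
by rewrite -(setD1K xA) -(setD1K xB) setUS.
Qed.

Lemma forest_link (T : finType) (F : {set {set T}}) x :
  forest F -> forest (link F x).
Proof.
move=> [_ Ff]; split.
  apply/imsetP => -[A]; rewrite inE => /and3P[_ A1 xA] /esym/eqP.
  by rewrite -cards_eq0 -(eqn_add2l (x \in A)) -cardsD1 xA; case: #|A| A1 => [|[]].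
move=> _ _ _ /imsetP[A + ->] /imsetP[B + ->] /imsetP[C + ->].
rewrite !inE => /and3P[AF _ xA] /and3P[BF _ xB] /and3P[CF _ xC].
by rewrite !setD1_subset //; exact: Ff.
Qed.

(** Two distinct singletons below one member would be incomparable. *)
Lemma link_sub (T : finType) (F : {set {set T}}) x B :
  forest F -> x \in roots F -> B \in link F x -> B \subset ~: roots F.
Proof.
move=> [_ Ff]; rewrite inE => xF /imsetP[A]; rewrite inE => /and3P[AF _ xA] ->.
apply/subsetP => y; rewrite !inE => /andP[yx yA]; apply/negP => yF.
have := Ff _ _ _ xF yF AF; rewrite !sub1set => /(_ xA yA).
by rewrite !inE [y == x]eq_sym orbb eq_sym (negPf yx).
Qed.

Lemma sum_link (R : realFieldType) (T : finType) (F : {set {set T}}) x (f : nat -> R) :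
  \sum_(A in F | (1 < #|A|)%N && (x \in A)) f #|A| =
  \sum_(B in link F x) f #|B|.+1.
Proof.
rewrite /link big_imset /=; last first.
  move=> A B; rewrite !inE => /and3P[_ _ xA] /and3P[_ _ xB] AB.
  by rewrite -(setD1K xA) -(setD1K xB) AB.
rewrite (eq_bigl (fun A => A \in [set A in F | (1 < #|A|)%N && (x \in A)])).
  by apply: eq_bigr => A; rewrite inE => /and3P[_ _ xA]; rewrite (cardsD1 x A) xA.
by move=> A; rewrite inE.
Qed.

(** * The upper bound for forests *)

Lemma forest_lubell_split (R : realFieldType) (T : finType) (F : {set {set T}}) :
  forest F -> (0 < #|T|)%N ->
  \sum_(A in F) 'C(#|T|, #|A|)%:R^-1 <=
  3 / 2 - #|roots F|%:R / #|T|%:R / 2 +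
  \sum_(x in roots F) \sum_(A in F | (1 < #|A|)%N && (x \in A))
     excess R #|A| / 'C(#|T|, #|A|)%:R :> R.
Proof.
move=> Ff T0; pose w (A : {set T}) : R := 'C(#|T|, #|A|)%:R^-1.
have w0 A : 0 <= w A by rewrite invr_ge0 ler0n.
pose rooted (A : {set T}) := (1 < #|A|)%N && [exists x in roots F, x \in A].
have lym : \sum_(A in F) avoid R F A * w A <= 1.
  have := avoid_lym_le R F [set: T]; rewrite cardsT.
  by rewrite (eq_bigl (fun A => A \in F)) // => A; rewrite subsetT andbT.
(* Scaled by 3/2, this charges 1 to every member, 3/2 to singletons and
   [1 - excess] to the members above a singleton. *)
have pt A : A \in F -> 2 / 3 + (if #|A| == 1%N then 1 / 3 else 0) -
    (if rooted A then 2 / 3 * excess R #|A| else 0) <= avoid R F A.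
  move=> AF; rewrite /rooted.
  have [/eqP/cards1P[x Ax]|A1] := eqVneq #|A| 1%N.
    by rewrite Ax cards1 /= avoid_singleton // -?Ax //; lra.
  have A_gt1 : (1 < #|A|)%N by move: (forest_card_gt0 Ff AF); lia.
  rewrite A_gt1 /=; case: ifP => [/existsP[x /andP[]]|nx].
    rewrite inE => xF xA; have := avoid_rooted R Ff AF A_gt1 xF xA.
    by rewrite /excess; lra.
  suff : 2 / 3 <= avoid R F A by lra.
  apply: avoid_unrooted => // x xA xF.
  by case/existsP: nx; exists x; rewrite inE xF.
have sum1 : \sum_(A in F | #|A| == 1%N) w A = #|roots F|%:R / #|T|%:R.
  have -> : #|roots F|%:R / #|T|%:R = \sum_(x in roots F) #|T|%:R^-1 :> R.
    by rewrite sumr_const -[RHS]mulr_natl.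
  rewrite (eq_bigl (fun A => A \in [set [set x] | x in roots F])); last first.
    move=> A; apply/andP/imsetP => [[AF /cards1P[x Ax]]|[x + ->]].
      by exists x; rewrite ?inE -?Ax.
    by rewrite inE cards1.
  rewrite big_imset /=; last by move=> x y _ _ /set1_inj.
  by apply: eq_bigr => x _; rewrite /w cards1 bin1.
(* Each rooted member is counted at some root it contains; counting it at all of them can only
   increase the nonnegative sum. *)
have rsum : \sum_(A in F | rooted A) excess R #|A| * w A <=
    \sum_(x in roots F) \sum_(A in F | (1 < #|A|)%N && (x \in A))
      excess R #|A| * w A.
  rewrite (exchange_big_dep (fun A => (A \in F) && rooted A)) /=; last first.
    move=> x A xF /and3P[-> A1 xA]; rewrite /rooted A1 /=.
    by apply/existsP; exists x; rewrite xF.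
  apply: ler_sum => A /and3P[AF A1 /existsP[x /andP[xF xA]]].
  rewrite (bigD1 x) /=; last by rewrite xF AF A1 xA.
  by rewrite lerDl sumr_ge0 // => y _; rewrite mulr_ge0 ?excess_ge0.
have : \sum_(A in F) (2 / 3 + (if #|A| == 1%N then 1 / 3 else 0) -
    (if rooted A then 2 / 3 * excess R #|A| else 0)) * w A <= 1.
  by apply: le_trans lym; apply: ler_sum => A AF; rewrite ler_wpM2r ?pt.
have -> : \sum_(A in F) (2 / 3 + (if #|A| == 1%N then 1 / 3 else 0) -
    (if rooted A then 2 / 3 * excess R #|A| else 0)) * w A =
  2 / 3 * (\sum_(A in F) w A) + 1 / 3 * (\sum_(A in F | #|A| == 1%N) w A) -
  2 / 3 * (\sum_(A in F | rooted A) excess R #|A| * w A).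
  rewrite !mulr_sumr [X in _ = _ + X - _]big_mkcondr [X in _ = _ - X]big_mkcondr.
  rewrite -big_split -sumrB; apply: eq_bigr => A _ /=.
  by case: ifP => _; case: ifP => _; rewrite ?mulrA; lra.
by rewrite sum1; lra.
Qed.

(** The link of a root lives on the [q * N] points that are not roots. Passing from ['C(N, b.+1)] to
    ['C(q * N, b)] costs a factor of about [b.+1 * q ^+ b / N], whence the weights of
    [link_weight_le]; the [p * N] roots together contribute about [p * K]. *)
Lemma forest_lubell_le (R : realFieldType) (T : finType) (F : {set {set T}}) :
  forest F -> (200 * 200 <= #|T|)%N ->
  \sum_(A in F) 'C(#|T|, #|A|)%:R^-1 <= 1581 / 1000 :> R.
Proof.
move=> Ff T4; have T0 : (0 < #|T|)%N by apply: leq_trans T4.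
apply: (le_trans (forest_lubell_split R Ff T0)).
set N : R := #|T|%:R; have N0 : 0 < N by rewrite ltr0n.
set p : R := #|roots F|%:R / N; pose q : R := 1 - p.
have qE : q = #|~: roots F|%:R / N.
  have N0' : N != 0 by rewrite gt_eqF.
  have NE : N = #|roots F|%:R + #|~: roots F|%:R by rewrite -natrD cardsC.
  by apply: (mulIf N0'); rewrite mulrBl mul1r !mulfVK // {1}NE addrC addKr.
have p0 : 0 <= p by rewrite divr_ge0 ?ler0n.
have q0 : 0 <= q by rewrite qE divr_ge0 ?ler0n.
have q1 : q <= 1 by rewrite /q; lra.
pose K : R := Num.max (3 / 4 * q ^+ 2 + 3 / 4 * q ^+ 3) (1 / 2 * q + 3 / 4 * q ^+ 2).
have linkle x : x \in roots F ->
    \sum_(A in F | (1 < #|A|)%N && (x \in A)) excess R #|A| / 'C(#|T|, #|A|)%:R <=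
    1001 / 1000 * K / N.
  move=> xF; rewrite (sum_link F x (fun b => excess R b / 'C(#|T|, b)%:R)).
  have Lf := forest_link x Ff.
  have q01 : 0 <= q <= 1 by rewrite q0.
  have LK := link_weight_le (~: roots F) Lf q01.
  have -> : 1001 / 1000 * K / N = (1001 / 1000 / N) * K by rewrite mulrAC.
  apply: le_trans (ler_wpM2l _ LK); last by rewrite divr_ge0 ?ltW //; lra.
  rewrite mulr_sumr [leRHS](eq_bigl (fun B => B \in link F x)); last first.
    by move=> B; apply: andb_idr => /(link_sub Ff xF).
  (* Members of size above 6 have zero excess, so [bin_ratio_le] is only needed for [#|B| <= 5]. *)
  apply: ler_sum => B BL; have [B5|B5] := leqP #|B| 5; last first.
    by rewrite excess_eq0 // mul0r mulr0 !mul0r mulr0.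
  have cB : (#|B| <= #|~: roots F|)%N by apply/subset_leq_card/(link_sub Ff xF).
  have := @bin_ratio_le R #|~: roots F| #|T| #|B| B5 T4; rewrite -/N.
  have -> : #|~: roots F|%:R = q * N by rewrite qE mulfVK // gt_eqF.
  have b1 : 0 < 'C(#|~: roots F|, #|B|)%:R :> R by rewrite ltr0n bin_gt0.
  have b2 : 0 < 'C(#|T|, #|B|.+1)%:R :> R.
    rewrite ltr0n bin_gt0; apply: leq_ltn_trans cB _.
    rewrite -[X in (_ < X)%N](cardsC (roots F)) -[X in (X < _)%N]add0n ltn_add2r.
    by apply/card_gt0P; exists x.
  move: (excess_ge0 R #|B|.+1); set d := excess _ _ => d0.
  set c1 : R := 'C(#|~: roots F|, #|B|)%:R in b1 *.
  set c2 : R := 'C(#|T|, #|B|.+1)%:R in b2 *.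
  rewrite exprMn exprS => H.
  have N0' : 0 < N ^+ #|B| by rewrite exprn_gt0.
  have {H} : c1 * N <= 1001 / 1000 * (#|B|.+1%:R * q ^+ #|B| * c2).
    rewrite -(ler_pM2r N0'); move: H.
    set y := N ^+ _; set z := q ^+ _; set j : R := _.+1%:R; lra.
  set z := q ^+ _; set j : R := _.+1%:R => H.
  rewrite ler_pdivrMr // -(ler_pM2r b1) -(ler_pM2r N0).
  have -> : 1001 / 1000 / N * (j * d * z / c1) * c2 * c1 * N =
    d * (1001 / 1000 * (j * z * c2)) by field; rewrite ?gt_eqF.
  by rewrite -mulrA ler_wpM2l.
have tot : \sum_(x in roots F) \sum_(A in F | (1 < #|A|)%N && (x \in A))
    excess R #|A| / 'C(#|T|, #|A|)%:R <= p * (1001 / 1000 * K).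
  apply: (le_trans (ler_sum _ linkle)); rewrite sumr_const.
  rewrite -[leLHS]mulr_natl /p le_eqVlt; apply/orP; left; apply/eqP.
  by field; rewrite gt_eqF.
have pK : p * K <= 8 / 100 + p / 2.
  have -> : p = 1 - q by rewrite /q; lra.
  rewrite /K maxEle; case: ifP => _.
    by have := cubic_bound q0 q1; lra.
  by have := quartic_bound q0 q1; lra.
have p1 : p <= 1 by rewrite /q in q0; lra.
(* The total is at most 1.5 + 1.001 * 0.08 + 0.0005 * [p], hence at most 1.58058. *)
rewrite -lerBrDl; apply: (le_trans tot); rewrite mulrCA; lra.
Qed.

(** * The three-part construction *)

Definition profile (T : finType) (X Y Z C : {set T}) : nat * nat * nat :=
  (#|C :&: X|, #|C :&: Y|, #|C :&: Z|).

Definition profiles : seq (nat * nat * nat) :=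
  [:: (0, 0, 0); (1, 0, 0); (1, 1, 0); (0, 2, 0); (0, 0, 2); (1, 1, 1);
      (0, 2, 1); (0, 1, 2)]%N.

(* The profile (0, 0, 0) is that of the empty set. *)
Definition profile_family (T : finType) (X Y Z : {set T}) : {set {set T}} :=
  [set C | profile X Y Z C \in profiles].

(** [dom a b c] says that in each part [A] is empty or [B] fills [C], which forces [A] into [B]
    whatever the actual sets below [C] are. Comparability thus reduces to a finite check on
    profiles. *)
Lemma profiles_chain :
  let le (a c : nat * nat * nat) :=
    [&& (a.1.1 <= c.1.1), (a.1.2 <= c.1.2) & (a.2 <= c.2)]%N in
  let dom (a b c : nat * nat * nat) :=
    [&& (a.1.1 == 0%N) || (b.1.1 == c.1.1), (a.1.2 == 0%N) || (b.1.2 == c.1.2)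
      & (a.2 == 0%N) || (b.2 == c.2)] in
  {in profiles & &, forall a b c, a != (0, 0, 0)%N -> b != (0, 0, 0)%N ->
     le a c -> le b c -> dom a b c || dom b a c}.
Proof.
move=> le dom a b c aP bP cP.
have /allP/(_ a aP)/allP/(_ b bP)/allP/(_ c cP) : all (fun a => all (fun b =>
  all (fun c => [&& a != (0, 0, 0)%N, b != (0, 0, 0)%N, le a c & le b c] ==>
    (dom a b c || dom b a c)) profiles) profiles) profiles by vm_compute.
by move=> /implyP H a0 b0 ac bc; apply: H; rewrite a0 b0 ac bc.
Qed.

Lemma setI_sub_dom (T : finType) (A B C P : {set T}) :
  A \subset C -> B \subset C -> (#|A :&: P| == 0%N) || (#|B :&: P| == #|C :&: P|) ->
  A :&: P \subset B.
Proof.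
move=> sAC sBC /orP[|/eqP eBC].
  by rewrite cards_eq0 => /eqP->; rewrite sub0set.
have /eqP e : B :&: P == C :&: P by rewrite eqEcard setSI //= eBC.
by apply: subset_trans (subsetIl B P); rewrite e setSI.
Qed.

Lemma cover3 (T : finType) (X Y Z A B : {set T}) :
  X :|: Y :|: Z = [set: T] ->
  A :&: X \subset B -> A :&: Y \subset B -> A :&: Z \subset B -> A \subset B.
Proof.
move=> cov AX AY AZ.
by rewrite -[A]setIT -cov !setIUr !subUset AX AY AZ.
Qed.

Lemma profile_family_chain (T : finType) (X Y Z A B C : {set T}) :
  X :|: Y :|: Z = [set: T] ->
  A \in profile_family X Y Z -> B \in profile_family X Y Z ->
  C \in profile_family X Y Z -> A != set0 -> B != set0 ->
  A \subset C -> B \subset C -> (A \subset B) || (B \subset A).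
Proof.
move=> cov; rewrite 3!in_set => AF BF CF A0 B0 sAC sBC.
have n0 (D : {set T}) : D != set0 -> profile X Y Z D != (0, 0, 0)%N.
  apply: contra => /eqP[/eqP DX /eqP DY /eqP DZ].
  by rewrite -subset0; apply: (cover3 cov); rewrite subset0 -cards_eq0.
have le (D E P : {set T}) : D \subset E -> (#|D :&: P| <= #|E :&: P|)%N.
  by move=> DE; apply/subset_leq_card/setSI.
have := profiles_chain AF BF CF (n0 A A0) (n0 B B0).
rewrite /= !le // => /(_ isT isT) /orP[] /and3P[dX dY dZ].
  apply/orP; left; apply: (cover3 cov).
  - exact: setI_sub_dom dX.
  - exact: setI_sub_dom dY.
  - exact: setI_sub_dom dZ.
apply/orP; right; apply: (cover3 cov).
- exact: setI_sub_dom dX.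
- exact: setI_sub_dom dY.
- exact: setI_sub_dom dZ.
Qed.

(** Triples of subsets of the parts inject into their unions, since intersecting with the parts
    recovers them. *)
Lemma card_profile (T : finType) (X Y Z : {set T}) (t : nat * nat * nat) :
  [disjoint X & Y] -> [disjoint X & Z] -> [disjoint Y & Z] ->
  ('C(#|X|, t.1.1) * 'C(#|Y|, t.1.2) * 'C(#|Z|, t.2) <=
   #|[set C | (profile X Y Z C == t) && (C \subset X :|: Y :|: Z)]|)%N.
Proof.
case: t => [[i j] k] XY XZ YZ /=.
pose D (P : {set T}) l := [set A : {set T} | A \subset P & #|A| == l].
pose g (u : {set T} * {set T} * {set T}) := u.1.1 :|: u.1.2 :|: u.2.
have I0 (P Q A : {set T}) : [disjoint P & Q] -> A \subset P -> A :&: Q = set0.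
  by move=> PQ AP; apply/eqP; rewrite setI_eq0; apply: disjointWl PQ.
have gI (a b c : {set T}) : a \subset X -> b \subset Y -> c \subset Z ->
  [/\ g (a, b, c) :&: X = a, g (a, b, c) :&: Y = b & g (a, b, c) :&: Z = c].
  move=> aX bY cZ; rewrite /g /= !setIUl.
  rewrite (I0 _ _ _ XY aX) (I0 _ _ _ XZ aX) (I0 _ _ _ YZ bY).
  rewrite (I0 Y X b) 1?disjoint_sym // (I0 Z X c) 1?disjoint_sym //.
  rewrite (I0 Z Y c) 1?disjoint_sym //.
  by rewrite !setU0 !set0U (setIidPl aX) (setIidPl bY) (setIidPl cZ).
rewrite -!cards_draws -/(D X i) -/(D Y j) -/(D Z k) -!cardsX.
rewrite -(card_in_imset (f := g)).
  apply/subset_leq_card/subsetP => _ /imsetP[[[a b] c] + ->].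
  rewrite !inE /= -!andbA => /and5P[aX /eqP ai bY /eqP bj /andP[cZ /eqP ck]].
  have [gX gY gZ] := gI a b c aX bY cZ.
  rewrite /profile gX gY gZ ai bj ck eqxx /=.
  by rewrite !eqxx /=; apply: setUSS => //; apply: setUSS.
move=> [[a b] c] [[a' b'] c']; rewrite !inE /= -!andbA.
move=> /and5P[aX _ bY _ /andP[cZ _]] /and5P[aX' _ bY' _ /andP[cZ' _]] e.
have [gX gY gZ] := gI a b c aX bY cZ; have [gX' gY' gZ'] := gI a' b' c' aX' bY' cZ'.
have ea : a = a' by rewrite -gX e gX'.
have eb : b = b' by rewrite -gY e gY'.
have ec : c = c' by rewrite -gZ e gZ'.
by rewrite ea eb ec.
Qed.

Lemma profile_lubell_ge (R : realFieldType) (T : finType) (X Y Z : {set T}) :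
  [disjoint X & Y] -> [disjoint X & Z] -> [disjoint Y & Z] ->
  X :|: Y :|: Z = [set: T] ->
  \sum_(t <- profiles) ('C(#|X|, t.1.1) * 'C(#|Y|, t.1.2) * 'C(#|Z|, t.2))%:R /
     'C(#|T|, t.1.1 + t.1.2 + t.2)%:R <=
  \sum_(C in profile_family X Y Z) 'C(#|T|, #|C|)%:R^-1 :> R.
Proof.
move=> XY XZ YZ cov.
have cardE (C : {set T}) : #|C| = (#|C :&: X| + #|C :&: Y| + #|C :&: Z|)%N.
  rewrite -{1}[C]setIT -cov !setIUr.
  have d1 : (C :&: X) :&: (C :&: Y) = set0.
    by rewrite -setIIr (disjoint_setI0 XY) setI0.
  have d2 : (C :&: X :|: C :&: Y) :&: (C :&: Z) = set0.
    by rewrite -setIUr -setIIr setIUl (disjoint_setI0 XZ) (disjoint_setI0 YZ) setU0 setI0.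
  by rewrite cardsU d2 cards0 subn0 cardsU d1 cards0 subn0.
apply: (@le_trans _ _ (\sum_(t <- profiles) \sum_(C : {set T} | profile X Y Z C == t)
    'C(#|T|, #|C|)%:R^-1)).
  apply: ler_sum => t _.
  rewrite (eq_bigr (fun=> 'C(#|T|, t.1.1 + t.1.2 + t.2)%:R^-1)); last first.
    by move=> C /eqP <- /=; rewrite -cardE.
  rewrite (eq_bigl (fun C => C \in
    [set C | (profile X Y Z C == t) && (C \subset X :|: Y :|: Z)])).
    rewrite sumr_const -[leRHS]mulr_natl ler_wpM2r ?invr_ge0 ?ler0n // ler_nat.
    exact: card_profile.
  by move=> C; rewrite inE cov subsetT andbT.
rewrite (exchange_big_dep predT) //= [leRHS]big_mkcond; apply: ler_sum => C _.
rewrite big_const_seq (@eq_count _ _ (pred1 (profile X Y Z C))); last first.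
  by move=> t; rewrite /= eq_sym.
(* The listed profiles are distinct, so each set is counted at most once. *)
by rewrite count_uniq_mem // in_set; case: (_ \in profiles); rewrite //= addr0.
Qed.

(** * Numerical value of the construction *)

Lemma natr_bin2 (R : realFieldType) (m : nat) :
  'C(m, 2)%:R = m%:R * (m%:R - 1) / 2 :> R.
Proof.
have /(congr1 (fun l : nat => l%:R : R)) := mul_bin_diag m 1.
case: m => [|m]; first by rewrite bin0n mul0r mul0r.
by rewrite /= bin1 !natrM -natr1; lra.
Qed.

Lemma natr_bin3 (R : realFieldType) (m : nat) :
  'C(m, 3)%:R = m%:R * (m%:R - 1) * (m%:R - 2) / 6 :> R.
Proof.
have /(congr1 (fun l : nat => l%:R : R)) := mul_bin_diag m 2.
case: m => [|m]; first by rewrite bin0n !mul0r.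
by rewrite /= !natrM natr_bin2 -natr1; lra.
Qed.

(** Enlarging the denominators to powers of [154 * t] leaves the limit value, above 2.281856404,
    minus less than [0.01 / t]. At [t >= 10 ^+ 7] this loss is below [10 ^- 9]. *)
Lemma profile_limit_ge (R : realFieldType) (t : R) : 10 ^+ 7 <= t ->
  2281856401%N%:R / 10 ^+ 9 <= 1 + 37 / 154 +
    (37 * t * (80 * t) + 80 * t * (80 * t - 1) / 2 + 37 * t * (37 * t - 1) / 2) /
      (154 * t * (154 * t - 1) / 2) +
    (37 * t * (80 * t) * (37 * t) + 80 * t * (80 * t - 1) / 2 * (37 * t) +
       80 * t * (37 * t * (37 * t - 1) / 2)) /
      (154 * t * (154 * t - 1) * (154 * t - 2) / 6).
Proof.
move=> t7; set c := (X in X <= _).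
have t0 : 0 < t by apply: lt_le_trans t7; rewrite exprn_gt0.
have t1 : 1 <= t by apply: le_trans t7; rewrite exprn_ege1 // ler1n.
have tn : t != 0 by rewrite gt_eqF.
have iv : t^-1 <= (10 ^+ 7)^-1 by rewrite lef_pV2 ?posrE ?exprn_gt0.
set N2 := (X in X / (154 * t * (154 * t - 1) / 2)).
set N3 := (X in X / (154 * t * (154 * t - 1) * (154 * t - 2) / 6)).
have b80 : 0 <= 80 * t * (80 * t - 1) / 2 by rewrite divr_ge0 // mulr_ge0 //; lra.
have b37 : 0 <= 37 * t * (37 * t - 1) / 2 by rewrite divr_ge0 // mulr_ge0 //; lra.
have p80 : 0 <= 80 * t by lra.
have p37 : 0 <= 37 * t by lra.
have N2_ge0 : 0 <= N2 by rewrite /N2 !addr_ge0 // mulr_ge0.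
have N3_ge0 : 0 <= N3.
  rewrite /N3 !addr_ge0 //; [|exact: mulr_ge0|exact: mulr_ge0].
  by rewrite (mulr_ge0 (mulr_ge0 p37 p80) p37).
have n2 : 0 < 154 * t * (154 * t - 1) / 2 by rewrite divr_gt0 // mulr_gt0 //; lra.
have n3 : 0 < 154 * t * (154 * t - 1) * (154 * t - 2) / 6.
  by rewrite divr_gt0 // !mulr_gt0 //; lra.
have d2 : N2 / (154 * t * (154 * t) / 2) <= N2 / (154 * t * (154 * t - 1) / 2).
  rewrite ler_wpM2l // lef_pV2 ?posrE //; last by rewrite divr_gt0 // mulr_gt0 //; lra.
  by rewrite ler_pM2r ?invr_gt0 // ler_pM2l; lra.
have d3 : N3 / (154 * t * (154 * t) * (154 * t) / 6) <=
    N3 / (154 * t * (154 * t - 1) * (154 * t - 2) / 6).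
  rewrite ler_wpM2l // lef_pV2 ?posrE //; last by rewrite divr_gt0 // !mulr_gt0 //; lra.
  rewrite ler_pM2r ?invr_gt0 //; apply: ler_pM; [|lra| |lra].
    by rewrite mulr_ge0; lra.
  by rewrite ler_pM2l; lra.
have e2 : N2 / (154 * t * (154 * t) / 2) =
    (2 * 37 * 80 + 80 * 80 + 37 * 37) / (154 * 154) - 117 / (154 * 154) * t^-1.
  by rewrite /N2; field.
have e3 : N3 / (154 * t * (154 * t) * (154 * t) / 6) =
    (6 * 37 * 80 * 37 + 3 * 80 * 80 * 37 + 3 * 80 * 37 * 37) / (154 * 154 * 154)
    - 6 * 80 * 37 / (154 * 154 * 154) * t^-1.
  by rewrite /N3; field.
move: d2 d3; rewrite e2 e3.
set u := N2 / _; set v := N3 / _ => d2 d3.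
apply: (@le_trans _ _ (1 + 37 / 154 +
 ((2 * 37 * 80 + 80 * 80 + 37 * 37) / (154 * 154) - 117 / (154 * 154) * t^-1) +
 ((6 * 37 * 80 * 37 + 3 * 80 * 80 * 37 + 3 * 80 * 37 * 37) / (154 * 154 * 154)
    - 6 * 80 * 37 / (154 * 154 * 154) * t^-1))); last by rewrite !lerD.
by rewrite /c; move: iv; set w := t^-1; clear; lra.
Qed.

Lemma profile_value_ge (R : realFieldType) (k : nat) : 10 ^+ 7 <= k%:R :> R ->
  2281856401%N%:R / 10 ^+ 9 <=
  \sum_(t <- profiles) ('C(37 * k, t.1.1) * 'C(80 * k, t.1.2) * 'C(37 * k, t.2))%:R /
     'C(154 * k, t.1.1 + t.1.2 + t.2)%:R :> R.
Proof.
move=> k7; set c := (X in X <= _).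
rewrite /profiles !big_cons big_nil /=.
rewrite ![addn _ _]/= !(bin0, bin1, muln1, mul1n, natrM, natr_bin2, natr_bin3).
move: (k%:R : R) k7 @c => t k7 c.
apply: (le_trans (profile_limit_ge k7)).
have t0 : t != 0 by rewrite gt_eqF // (lt_le_trans _ k7) ?exprn_gt0.
rewrite le_eqVlt; apply/orP; left; apply/eqP.
move: (154 * t * (154 * t - 1) / 2) (154 * t * (154 * t - 1) * (154 * t - 2) / 6).
move=> d2 d3; rewrite !mul1r !mulr1 invr1 addr0.
have -> : 37 * t / (154 * t) = 37 / 154 :> R by field.
have reassoc (u A B C D E F : R) : 1 + u + (A + B + C) / d2 + (D + E + F) / d3 =
  1 + (u + (A / d2 + (B / d2 + (C / d2 + (D / d3 + (E / d3 + F / d3)))))) by ring.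
exact: reassoc.
Qed.

(** * Diamonds and forests *)

Lemma le_boolean_lattice2 (x y : boolean_lattice 2) :
  (x <= y)%O = ((ord0 \in (x : {set 'I_2})) ==> (ord0 \in (y : {set 'I_2}))) &&
               ((ord_max \in (x : {set 'I_2})) ==> (ord_max \in (y : {set 'I_2}))).
Proof.
have -> : (x <= y)%O = ((x : {set 'I_2}) \subset (y : {set 'I_2})).
  exact: Order.SetSubsetOrder.leEsubset.
apply/subsetP/andP => [xy|[/implyP x0 /implyP x1] i].
  by split; apply/implyP => /xy.
have [->|->//] : i = ord0 \/ i = ord_max.
  by case: i => [[|[|//]] Hi]; [left|right]; apply: val_inj.
done.
Qed.

(** Incomparable members [A], [B] below [C] would form a diamond together with [C] and the empty
    set. *)
Lemma diamond_free_forest (n : nat) (F : {set {set 'I_n}}) :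
  finset.set0 \in F -> poset_free (boolean_lattice 2) F -> forest (F :\ finset.set0).
Proof.
move=> F0 Ffree; split; first by rewrite !inE eqxx.
move=> A B C; rewrite !inE => /andP[A0 AF] /andP[B0 BF] /andP[_ CF] sAC sBC.
apply/negPn/negP; rewrite negb_or => /andP[AB BA]; apply: Ffree.
pose f (s : boolean_lattice 2) : {set 'I_n} :=
  if ord0 \in (s : {set 'I_2}) then
    (if ord_max \in (s : {set 'I_2}) then C else A)
  else (if ord_max \in (s : {set 'I_2}) then B else finset.set0).
have CA : ~~ (C \subset A) by apply: contra BA; exact: subset_trans.
have CB : ~~ (C \subset B) by apply: contra AB; exact: subset_trans.
have C0 : C != finset.set0.
  by apply: contra A0 => /eqP C0; rewrite -subset0 -C0.
have f_le x y : (f x \subset f y) = (x <= y)%O.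
  rewrite le_boolean_lattice2 /f; do 4!case: ifP => _ /=;
  by rewrite ?subxx ?sub0set ?subset0 ?sAC ?sBC ?(negPf AB) ?(negPf BA)
             ?(negPf CA) ?(negPf CB) ?(negPf A0) ?(negPf B0) ?(negPf C0).
exists (f @: [set: boolean_lattice 2]).
  apply/subsetP => _ /imsetP[s _ ->]; rewrite /f.
  by do 2!case: ifP => _.
exists f; split => //.
- move=> x y fxy; apply/eqP; rewrite eq_le -!f_le fxy subxx //.
- by apply/setP => D; apply/imsetP/imsetP => -[s _ ->]; exists s.
Qed.

(** The two atoms of a copy are incomparable, hence nonempty, and lie below its top, against
    [profile_family_chain]. *)
Lemma profile_family_free (n : nat) (X Y Z : {set 'I_n}) :
  X :|: Y :|: Z = [set: 'I_n] ->
  poset_free (boolean_lattice 2) (profile_family X Y Z).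
Proof.
move=> cov [G GF [f [_ fG f_le]]].
have fF s : f s \in profile_family X Y Z.
  by rewrite (subsetP GF) // -fG imset_f.
pose o0 : {set 'I_2} := [set ord0]; pose o1 : {set 'I_2} := [set ord_max].
pose a : boolean_lattice 2 := o0; pose b : boolean_lattice 2 := o1.
pose t : boolean_lattice 2 := [set: 'I_2].
have ab : ~~ (f a \subset f b) by rewrite f_le le_boolean_lattice2 !inE.
have ba : ~~ (f b \subset f a) by rewrite f_le le_boolean_lattice2 !inE.
have at' : f a \subset f t by rewrite f_le le_boolean_lattice2 !inE.
have bt : f b \subset f t by rewrite f_le le_boolean_lattice2 !inE.
have a0 : f a != finset.set0 by apply: contraNneq ab => ->; rewrite sub0set.
have b0 : f b != finset.set0 by apply: contraNneq ba => ->; rewrite sub0set.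
have := profile_family_chain cov (fF a) (fF b) (fF t) a0 b0 at' bt.
by rewrite (negPf ab) (negPf ba).
Qed.

Lemma profile_family_set0 (T : finType) (X Y Z : {set T}) :
  finset.set0 \in profile_family X Y Z.
Proof. by rewrite inE /profile !set0I cards0. Qed.

Lemma card_ord_range (n l m : nat) : (l <= m <= n)%N ->
  #|[set i : 'I_n | (l <= i < m)%N]| = (m - l)%N.
Proof.
move=> /andP[lm mn]; rewrite -sum1_card.
rewrite (eq_bigl (fun i : 'I_n => (l <= i < m)%N)); last by move=> i; rewrite inE.
rewrite -(big_mkord (fun i => (l <= i < m)%N) (fun=> 1%N)).
rewrite -(big_nat_widen 0 m n (fun i => l <= i)%N (fun=> 1%N)) //.
by rewrite -(big_nat_widenl l 0 m predT) // sum_nat_const_nat muln1.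
Qed.

(** * Bounds for diamond-free families and passage to the limsup *)

Lemma diamond_free_lubell_le (R : realType) (n : nat) (F : {set {set 'I_n}}) :
  (200 * 200 <= n)%N -> finset.set0 \in F -> poset_free (boolean_lattice 2) F ->
  lubell R F <= 2581 / 1000.
Proof.
move=> n4 F0 Ff; rewrite /lubell (big_setD1 finset.set0 F0) /= cards0 bin0 invr1.
have := @forest_lubell_le R _ _ (diamond_free_forest F0 Ff); rewrite card_ord.
by move=> /(_ n4); lra.
Qed.

Lemma diamond_free_lubell_ge (R : realType) (n0 : nat) :
  exists n, (n0 <= n)%N /\ exists F : {set {set 'I_n}},
    [/\ finset.set0 \in F, poset_free (boolean_lattice 2) F
      & 2281856401%N%:R / 10 ^+ 9 <= lubell R F].
Proof.
have [k [k0 k7]] : exists k, (n0 <= k)%N /\ 10 ^+ 7 <= k%:R :> R.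
  exists (n0 + 10 ^ 7)%N; split; first exact: leq_addr.
  by rewrite natrD natrX lerDr ler0n.
pose n := (154 * k)%N; exists n; split; first by rewrite /n; lia.
pose P l m : {set 'I_n} := [set i : 'I_n | (l <= i < m)%N].
pose X := P 0%N (37 * k)%N; pose Y := P (37 * k)%N (117 * k)%N.
pose Z := P (117 * k)%N n.
have cov : X :|: Y :|: Z = [set: 'I_n].
  by apply/setP => i; rewrite !inE; have := ltn_ord i; lia.
have dis l m l' m' : (m <= l')%N -> [disjoint P l m & P l' m'].
  move=> ml; rewrite -setI_eq0; apply/eqP/setP => i; rewrite !inE; lia.
exists (profile_family X Y Z); split.
- exact: profile_family_set0.
- exact: profile_family_free.
apply: (le_trans (profile_value_ge k7)).
have cX : #|X| = (37 * k)%N by rewrite card_ord_range ?subn0 // /n; lia.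
have cY : #|Y| = (80 * k)%N by rewrite card_ord_range /n; lia.
have cZ : #|Z| = (37 * k)%N by rewrite card_ord_range /n; lia.
rewrite /lubell; have := @profile_lubell_ge R _ X Y Z.
rewrite cX cY cZ card_ord; apply => //; apply: dis => //; lia.
Qed.

From mathcomp Require Import all_classical all_reals all_analysis.

Theorem theorem4p4 (R : realType) :
  ((22818564%N%:R / 10 ^+ 7)%:E < rho_star R (boolean_lattice 2))%E /\
  (rho_star R (boolean_lattice 2) < (25823284%N%:R / 10 ^+ 7)%:E)%E.
Proof.
rewrite /rho_star; set u := (X in limn_esup X); split.
  apply: (@lt_le_trans _ _ (2281856401%N%:R / 10 ^+ 9)%:E).
    by rewrite lte_fin; lra.
  (* The limsup is the infimum, over sets [V] containing all large [n], of the supremum of [u] on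
     [V]. A lower bound reached at arbitrarily large [n] bounds each supremum; the upper bound below
     needs just one [V]. *)
  apply: le_ereal_inf_tmp => _ [V [n0 _ n0V] <-].
  have [n [n0n [F [F0 Ff lF]]]] := diamond_free_lubell_ge R n0.
  apply: le_ereal_sup_tmp; exists (u n); first by exists n => //; apply: n0V.
  by apply: le_ereal_sup_tmp; exists (lubell R F)%:E; [exists F | rewrite lee_fin].
apply: (@le_lt_trans _ _ (2581 / 1000)%:E); last by rewrite lte_fin; lra.
pose V : set nat := fun n => (200 * 200 <= n)%N.
apply: ge_ereal_inf; exists (ereal_sup (u @` V)%classic).
  by exists V => //; exists (200 * 200)%N.
apply: ge_ereal_sup => _ [n n4 <-]; apply: ge_ereal_sup => _ [F [F0 Ff] <-].
by rewrite lee_fin; apply: diamond_free_lubell_le.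
Qed.
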